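(* Let $n\ge 1$. The projection $\pi(\operatorname{Koz}(n))\subseteq\mathbb R^n$ of the Kozlov simplex has the description $$\pi\bigl(\operatorname{Koz}(n)\bigr)=\Bigl\{x\in\mathbb R^n : x_1=n,\quad \frac{x_1}{\binom n1}\ge\frac{x_2}{\binom n2}\ge\cdots\ge\frac{x_n}{\binom nn}\ge 0\Bigr\},$$ and for $n\ge 2$ these $n$ inequalities (namely $x_j/\binom nj\ge x_{j+1}/\binom n{j+1}$ for $1\le j\le n-1$, and $x_n\ge 0$) are exactly its facets. For $1\le j\le n-1$ the facet opposite the vertex $\tilde F_j$ is cut out by $$\frac{x_j}{\binom nj}=\frac{x_{j+1}}{\binom n{j+1}},$$ and the facet opposite $\tilde F_n$ is cut out by $x_n=0$.
   Context: $[n]=\{1,\dots,n\}$. A simplicial complex on $[n]$ is a family $\Delta$ of subsets of $[n]$, closed under taking subsets, containing $\emptyset$ and every singleton $\{i\}$, $i\in[n]$; $\mathcal S_n$ is the set of these. $f_j(\Delta)$ is the number of $\sigma\in\Delta$ with $|\sigma|=j$. Put $S_n=\{(f_0(\Delta),f_1(\Delta),\dots,f_n(\Delta)):\Delta\in\mathcal S_n\}\subseteq\mathbb Z^{n+1}$ and $\operatorname{Koz}(n)=\operatorname{conv}(S_n)\subseteq\mathbb R^{n+1}$ (the Kozlov simplex). The map $\pi:\mathbb R^{n+1}\to\mathbb R^n$, $(x_0,x_1,\dots,x_n)\mapsto(x_1,\dots,x_n)$, forgets the degree-$0$ entry. For $1\le j\le n$, $\tilde F_j=\bigl(\binom n1,\dots,\binom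 nj,0,\dots,0\bigr)\in\mathbb R^n$. The polytope $\pi(\operatorname{Koz}(n))$ is an $(n-1)$-simplex with vertices $\tilde F_1,\dots,\tilde F_n$ (Kozlov's theorem); the facet opposite $\tilde F_j$ is the convex hull of the other vertices $\tilde F_\ell$, $\ell\ne j$. *)

(* Defs.v *)
(* MathComp / MathComp-Analysis. *)
From mathcomp Require Export all_boot all_order all_algebra.
From mathcomp Require Export boolp classical_sets reals convex.

Set Implicit Arguments.
Unset Strict Implicit.
Unset Printing Implicit Defensive.

Import Order.TTheory GRing.Theory Num.Theory.

Local Open Scope classical_set_scope.
Local Open Scope ring_scope.

(* The vertex set [n] = {1, ..., n} is represented by 'I_n. *)
Definition simplicial_complex n (D : {set {set 'I_n}}) : Prop :=
  [/\ finset.set0 \in D,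
      forall i : 'I_n, [set i]%SET \in D
    & forall s t : {set 'I_n}, t \subset s -> s \in D -> t \in D].

(* Faces are counted by cardinality, not by dimension: f_0 = 1, f_1 = n. *)
Definition fnum n (D : {set {set 'I_n}}) (j : nat) : nat :=
  #|[set s in D | #|s| == j]%SET|.

Definition fvector (R : realType) n (D : {set {set 'I_n}}) : 'rV[R]_n.+1 :=
  \row_(j < n.+1) (fnum D j)%:R.

Definition conv_hull (R : realType) n (A : set 'rV[R]_n) : set 'rV[R]_n :=
  smallest (fun B : set 'rV[R]_n => convex_set B) A.

Definition Koz (R : realType) n : set 'rV[R]_n.+1 :=
  conv_hull [set fvector R D | D in @simplicial_complex n].
Arguments Koz : clear implicits.

(* Entry 0 is dropped: column i of the image is entry i.+1 of x. *)
Definition forget0 (R : realType) n (x : 'rV[R]_n.+1) : 'rV[R]_n :=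
  \row_(i < n) x ord0 (lift ord0 i).

Definition projKoz (R : realType) n : set 'rV[R]_n := @forget0 R n @` Koz R n.
Arguments projKoz : clear implicits.

(* The coordinate x_j of x = (x_1, ..., x_n), numbered from 1; the value is 0
   when j is not in {1, ..., n}. *)
Definition crd (R : realType) n (x : 'rV[R]_n) (j : nat) : R :=
  if j is i.+1 then (if insub i is Some k then x ord0 k else 0) else 0.

Definition Ftilde (R : realType) n (j : nat) : 'rV[R]_n :=
  \row_(i < n) (if (i.+1 <= j)%N then 'C(n, i.+1)%:R else 0).

Definition opposite_facet (R : realType) n (j : nat) : set 'rV[R]_n :=
  conv_hull [set Ftilde R n l |
              l in [set l : nat | (1 <= l <= n)%N && (l != j)]].
Arguments opposite_facet : clear implicits.

Definition affinely_independent (R : realType) n k (p : 'I_k -> 'rV[R]_n) :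
    Prop :=
  forall a : 'I_k -> R,
    \sum_i a i = 0 -> \sum_i a i *: p i = 0 -> forall i, a i = 0.

(* A has affine dimension d: the largest affinely independent families of
   points of A have d + 1 members. *)
Definition has_affine_dim (R : realType) n (A : set 'rV[R]_n) (d : nat) :
    Prop :=
  (exists p : 'I_d.+1 -> 'rV[R]_n,
     (forall i, A (p i)) /\ affinely_independent p) /\
  (forall p : 'I_d.+2 -> 'rV[R]_n,
     (forall i, A (p i)) -> ~ affinely_independent p).

(* Faces are taken in the sense of valid inequalities; c = 0 gives the whole
   polytope and the empty face. *)
Definition is_face (R : realType) n (P F : set 'rV[R]_n) : Prop :=
  exists (c : 'rV[R]_n) (b : R),
    (forall x : 'rV[R]_n, P x -> \sum_i c ord0 i * x ord0 i <= b) /\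
    F = P `&` [set x : 'rV[R]_n | \sum_i c ord0 i * x ord0 i = b].

Definition is_facet (R : realType) n (P F : set 'rV[R]_n) : Prop :=
  is_face P F /\
  exists d, has_affine_dim P d.+1 /\ has_affine_dim F d.

(* The locus where the j-th of the n inequalities, 1 <= j <= n, is an
   equality; the n-th inequality is x_n >= 0. *)
Definition tight (R : realType) n (j : nat) : set 'rV[R]_n :=
  if (j < n)%N then
    [set x | crd x j / 'C(n, j)%:R = crd x j.+1 / 'C(n, j.+1)%:R]
  else [set x | crd x n = 0].
Arguments tight : clear implicits.

(* Main.v *)
(* The points Ftilde 1, ..., Ftilde n form a basis of R^n in which x has the
   coordinates x_i / C(n, i) - x_{i+1} / C(n, i+1), and these add up to x_1 / n.
   The listed conditions thus describe the simplex with vertices Ftilde j, and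
   the j-th inequality says that the j-th barycentric coordinate is nonnegative.
   Skeleta of the full simplex realize the vertices, while the local LYM
   inequality (j+1) f_{j+1} <= (n-j) f_j puts every f-vector in the simplex.
   A valid inequality is tight at exactly the points supported on the vertices
   where it is tight, so the faces correspond to sets of vertices, and a face
   has codimension one exactly when it omits a single vertex. *)
From HB Require Import structures.
Require Import Defs.
From mathcomp Require Import interval_inference.

Set Implicit Arguments.
Unset Strict Implicit.
Unset Printing Implicit Defensive.

Import Order.TTheory GRing.Theory Num.Theory.
Local Open Scope classical_set_scope.
Local Open Scope ring_scope.

(** * Convex sets and finite convex combinations *)

Lemma convex_setP (R : realType) (M : lmodType R) (A : set M) :
  convex_set A <->
  forall (x y : M) (t : R), 0 <= t -> t <= 1 -> A x -> A y ->
    A (t *: x + (1 - t) *: y).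
Proof.
split=> [cA x y t t0 t1 Ax Ay | cA x y l /set_mem Ax /set_mem Ay].
  have t01 : Itv.spec
      (@Itv.num_sem R)
      (Itv.Real `[0%Z, 1%Z]) t.
    by rewrite /= /Itv.num_sem/= in_itv/= t0 t1 ger0_real.
  have := cA x y (Itv.mk t01) (mem_set Ax) (mem_set Ay).
  exact: set_mem.
by apply: mem_set; apply: cA; [exact: ge0|exact: le1| |].
Qed.

Lemma convex_set_sum (R : realType) (M : lmodType R) (B : set M) (I : Type)
    (r : seq I) (a : I -> R) (p : I -> M) :
  convex_set B -> (forall i, 0 <= a i) -> (forall i, a i != 0 -> B (p i)) ->
  \sum_(i <- r) a i = 1 -> B (\sum_(i <- r) a i *: p i).
Proof.
move=> /convex_setP cB a0 pB s1.
(* Tails of the list have total weight other than 1, so the induction runs on the normalized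
   combination, which requires a positive total. *)
suff: 0 < \sum_(i <- r) a i ->
    B ((\sum_(i <- r) a i)^-1 *: \sum_(i <- r) a i *: p i).
  by rewrite s1 invr1 scale1r; apply; exact: ltr01.
elim: r {s1} => [|i r IH]; first by rewrite big_nil ltxx.
rewrite !big_cons; have [ai0|ai0] := eqVneq (a i) 0.
  by rewrite ai0 add0r scale0r add0r.
set s := \sum_(j <- r) a j; set S := \sum_(j <- r) _.
have : 0 <= s by apply: sumr_ge0.
(* A tail of total weight 0 cannot be normalized, but then all its terms vanish and only [p i]
   remains. *)
rewrite le_eqVlt => /orP[/eqP s0|s0 t0].
  have S0 : S = 0.
    rewrite /S; move/eqP: s0; rewrite eq_sym /s; elim: (r) => [|j r' IHr].
      by rewrite !big_nil.
    rewrite !big_cons paddr_eq0// ?sumr_ge0// => /andP[/eqP-> /IHr ->].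
    by rewrite scale0r addr0.
  by rewrite -s0 S0 !addr0 scalerA mulVf// scale1r => _; apply: pB.
have -> : (a i + s)^-1 *: (a i *: p i + S) =
   (a i / (a i + s)) *: p i + (1 - a i / (a i + s)) *: (s^-1 *: S).
  rewrite scalerDr !scalerA mulrC; congr (_ + _ *: _).
  by rewrite -(@divff _ (a i + s)) ?gt_eqF// -mulrBl addrAC subrr add0r
    mulrAC divff ?gt_eqF// mul1r.
apply: cB; [exact: divr_ge0 (ltW _)| |exact: pB|exact: IH].
by rewrite ler_pdivrMr// mul1r lerDl ltW.
Qed.

(** * Barycentric coordinates *)

Lemma crd_ord (R : realType) n (x : 'rV[R]_n) (i : 'I_n) :
  crd x i.+1 = x ord0 i.
Proof. by rewrite /crd valK. Qed.

Lemma crd_gt (R : realType) n (x : 'rV[R]_n) j : (n < j)%N -> crd x j = 0.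
Proof. by case: j => // j; rewrite ltnS /crd leqNgt => ?; rewrite insubN. Qed.

Lemma crd_linear (R : realType) n (a : R) (x y : 'rV[R]_n) j :
  crd (a *: x + y) j = a * crd x j + crd y j.
Proof.
case: j => [|j] /=; first by rewrite mulr0 addr0.
by case: insubP => [i _ _|_]; rewrite ?mxE ?mulr0 ?addr0.
Qed.

Definition normalized_crd (R : realType) n (x : 'rV[R]_n) (j : nat) : R :=
  crd x j / 'C(n, j)%:R.

(* Barycentric coordinates with respect to Ftilde 1, ..., Ftilde n.  At the
   last index the subtracted term is crd x n.+1 / 'C(n, n.+1) = 0 / 0 = 0. *)
Definition bary (R : realType) n (x : 'rV[R]_n) : 'rV[R]_n :=
  \row_(i < n) (normalized_crd x i.+1 - normalized_crd x i.+2).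

Lemma bary_is_linear (R : realType) n : linear (@bary R n).
Proof.
move=> a x y; apply/rowP => i; rewrite !mxE /normalized_crd !crd_linear.
by rewrite !mulrDl -!mulrA mulrBr opprD addrACA.
Qed.

HB.instance Definition _ (R : realType) n :=
  GRing.isLinear.Build R 'rV[R]_n 'rV[R]_n _ (@bary R n) (@bary_is_linear R n).

Lemma normalized_crd_gt (R : realType) n (x : 'rV[R]_n) j :
  (n < j)%N -> normalized_crd x j = 0.
Proof. by move=> nj; rewrite /normalized_crd crd_gt// mul0r. Qed.

Lemma binR_neq0 (R : realType) n j : (j <= n)%N -> 'C(n, j)%:R != 0 :> R.
Proof. by move=> jn; rewrite pnatr_eq0 -lt0n bin_gt0. Qed.

Lemma bary_Ftilde (R : realType) n (k : 'I_n) :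
  bary (Ftilde R n k.+1) = 'e_k.
Proof.
have nc j : normalized_crd (Ftilde R n k.+1) j.+1 = (j <= k)%:R.
  have [jn|nj] := ltnP j n; last first.
    by rewrite normalized_crd_gt// leqNgt (leq_trans (ltn_ord k) nj).
  rewrite /normalized_crd (crd_ord _ (Ordinal jn)) mxE /= ltnS.
  by case: leqP => _; rewrite ?mul0r// divff// binR_neq0.
apply/rowP => i; rewrite !mxE !nc eqxx /= -(inj_eq val_inj) /=.
by case: (ltngtP i k) => _; rewrite ?subrr ?subr0.
Qed.

(** Telescoping; the upper end [normalized_crd x n.+1] lies beyond the last coordinate and is 0. *)
Lemma bary_tail (R : realType) n (x : 'rV[R]_n) k :
  (k <= n)%N -> \sum_(i < n | (k <= i)%N) bary x ord0 i = normalized_crd x k.+1.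
Proof.
move=> kn; pose F i := normalized_crd x i.+1 - normalized_crd x i.+2.
transitivity (\sum_(k <= i < n) F i).
  by rewrite big_geq_mkord; apply: eq_bigr => i _; rewrite mxE.
transitivity (- \sum_(k <= i < n)
    (normalized_crd x i.+2 - normalized_crd x i.+1)).
  by rewrite -sumrN; apply: eq_bigr => i _; rewrite opprB.
rewrite (@telescope_sumr _ _ _ (fun i => normalized_crd x i.+1))//.
by rewrite opprB (normalized_crd_gt _ (ltnSn n)) subr0.
Qed.

(** [Ftilde R n i.+1] has entry ['C(n, k.+1)] at [k] if [k <= i] and 0 otherwise, so entry [k] of
    the sum is a tail sum of [bary x]. *)
Lemma baryK (R : realType) n (x : 'rV[R]_n) :
  \sum_i bary x ord0 i *: Ftilde R n i.+1 = x.
Proof.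
apply/rowP => k; rewrite summxE.
transitivity (\sum_(i < n | (k <= i)%N) bary x ord0 i * 'C(n, k.+1)%:R).
  rewrite [RHS]big_mkcond; apply: eq_bigr => i _; rewrite !mxE ltnS.
  by case: ifP; rewrite ?mulr0.
rewrite -mulr_suml bary_tail ?(ltnW (ltn_ord k))// /normalized_crd crd_ord.
by rewrite mulfVK// binR_neq0.
Qed.

Lemma bary_inj (R : realType) n : injective (@bary R n).
Proof. by move=> x y xy; rewrite -[x]baryK -[y]baryK xy. Qed.

Lemma sum_bary (R : realType) n (x : 'rV[R]_n) :
  \sum_i bary x ord0 i = crd x 1 / n%:R.
Proof.
by have := bary_tail x (leq0n n); rewrite /normalized_crd bin1 => <-.
Qed.

(** * Faces of the simplex, indexed by sets of vertices *)

Definition simplex_face (R : realType) n (K : {set 'I_n}) : set 'rV[R]_n :=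
  [set x | [/\ \sum_i bary x ord0 i = 1, forall i, 0 <= bary x ord0 i
             & forall i, i \notin K -> bary x ord0 i = 0]].
Arguments simplex_face : clear implicits.

Lemma simplex_face_Ftilde (R : realType) n (K : {set 'I_n}) (k : 'I_n) :
  simplex_face R n K (Ftilde R n k.+1) <-> k \in K.
Proof.
split=> [[_ _ K0]|kK].
  apply/negPn/negP => /K0; rewrite bary_Ftilde mxE !eqxx => /eqP.
  by rewrite oner_eq0.
split=> [|i|i iK]; rewrite ?bary_Ftilde ?mxE ?eqxx//.
  rewrite (bigD1 k)//= big1 ?addr0 => [|i ik]; rewrite mxE ?eqxx//.
  by rewrite (negPf ik).
by case: eqP => // ik; rewrite ik kK in iK.
Qed.

(** The vertices lying on a face recover [K]; this keeps the facets distinct. *)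
Lemma simplex_face_inj (R : realType) n (K K' : {set 'I_n}) :
  simplex_face R n K = simplex_face R n K' -> K = K'.
Proof.
move=> KK'; apply/setP => k.
by apply/idP/idP => /(simplex_face_Ftilde R) kK; apply/(simplex_face_Ftilde R);
  rewrite ?KK' // -KK'.
Qed.

Lemma convex_simplex_face (R : realType) n (K : {set 'I_n}) :
  convex_set (simplex_face R n K).
Proof.
apply/convex_setP => x y t t0 t1 [x1 x0 xK] [y1 y0 yK].
have baryE i : bary (t *: x + (1 - t) *: y) ord0 i =
    t * bary x ord0 i + (1 - t) * bary y ord0 i.
  by rewrite linearD !linearZ !mxE.
split=> [|i|i iK]; rewrite ?baryE.
- under eq_bigr do rewrite baryE.
  by rewrite big_split /= -!mulr_sumr x1 y1 !mulr1 addrC subrK.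
- by rewrite addr_ge0// mulr_ge0// subr_ge0.
- by rewrite xK// yK// !mulr0 addr0.
Qed.

Lemma simplex_face_sub (R : realType) n (K : {set 'I_n}) (B : set 'rV[R]_n) :
  convex_set B -> (forall k, k \in K -> B (Ftilde R n k.+1)) ->
  simplex_face R n K `<=` B.
Proof.
move=> cB KB x [x1 x0 xK]; rewrite -[x]baryK.
apply: convex_set_sum => // i xi0; apply: KB.
by apply: contraNT xi0 => /xK ->.
Qed.

Lemma conv_hull_Ftilde (R : realType) n (P : set nat) (K : {set 'I_n}) :
  (forall l, P l -> (1 <= l <= n)%N) ->
  (forall k : 'I_n, P k.+1 <-> k \in K) ->
  conv_hull [set Ftilde R n l | l in P] = simplex_face R n K.
Proof.
move=> Pn PK; apply/seteqP; split.
  apply: smallest_sub; first exact: convex_simplex_face.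
  move=> _ [l Pl <-]; have /andP[l0 ln] := Pn _ Pl.
  case: l => // l in Pl l0 ln *.
  by apply/(simplex_face_Ftilde R _ (Ordinal ln))/PK.
move=> x xK B [cB PB]; apply: simplex_face_sub xK => // k /PK Pk.
by apply: PB; exists k.+1.
Qed.

(** * Affine dimension *)

Lemma has_affine_dim_uniq (R : realType) n (A : set 'rV[R]_n) d e :
  has_affine_dim A d -> has_affine_dim A e -> d = e.
Proof.
wlog de : d e / (d < e)%N => [wh Ad Ae|].
  by have [/wh|/wh h|//] := ltngtP d e; [apply|apply/esym/h].
(* The first [d.+2] of the [e.+1] independent points are again independent, against the maximality
   of [d]. *)
move=> [_ noA] [[p [pA p_free]] _].
have le2 : (d.+2 <= e.+1)%N := de.
case: (noA (fun i => p (widen_ord le2 i))) => [i //|a a0 ap i].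
(* Extension by zero turns a dependence among the first points into one of the whole family. *)
pose b (j : 'I_e.+1) : R := if insub (val j) is Some i then a i else 0.
have bE j : b (widen_ord le2 j) = a j by rewrite /b /= valK.
have b0 (j : 'I_e.+1) : ~~ (j < d.+2)%N -> b j = 0.
  by move=> jd; rewrite /b insubN.
have bsum (V : lmodType R) (f : 'I_e.+1 -> V) :
    \sum_j b j *: f j = \sum_i a i *: f (widen_ord le2 i).
  rewrite (bigID (fun j : 'I_e.+1 => (j < d.+2)%N)) /= addrC big1 ?add0r.
    by rewrite (big_ord_narrow le2); apply: eq_bigr => j _; rewrite bE.
  by move=> j /b0 ->; rewrite scale0r.
rewrite -bE p_free// ?bsum//.
rewrite -[RHS]a0; have := bsum R^o (fun=> 1).
by under eq_bigr do rewrite -[_ *: _]/(_ * _) mulr1;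
  under [in RHS]eq_bigr do rewrite -[_ *: _]/(_ * _) mulr1.
Qed.

(** The vertices in [K] are independent because [bary] sends them to unit vectors. No larger family
    is independent, as barycentric coordinates on the face are supported on [K]. *)
Lemma simplex_face_dim (R : realType) n (K : {set 'I_n}) d :
  #|K| = d.+1 -> has_affine_dim (simplex_face R n K) d.
Proof.
move=> Kd; split.
  pose k (i : 'I_d.+1) : 'I_n := enum_val (cast_ord (esym Kd) i).
  exists (fun i => Ftilde R n (k i).+1); split=> [i|a _ a0 i].
    by apply/simplex_face_Ftilde/enum_valP.
  have /rowP/(_ (k i)) := congr1 (@bary R n) a0.
  rewrite linear_sum linear0 summxE mxE (bigD1 i)//= big1 => [|j ji].
    by rewrite linearZ /= bary_Ftilde !mxE !eqxx mulr1 addr0.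
  rewrite linearZ /= bary_Ftilde !mxE eqxx /=; case: eqP; rewrite ?mulr0//.
  by move=> /enum_val_inj/cast_ord_inj ij; rewrite ij eqxx in ji.
move=> p pK p_free.
pose M : 'M[R]_(d.+2, #|K|) := \matrix_(i, j) bary (p i) ord0 (enum_val j).
(* [M] has [d.+2] rows but only [d.+1] columns, so its rows cannot be free. *)
suff : row_free M.
  by rewrite -row_leq_rank leqNgt ltnS (leq_trans (rank_leq_col M))// Kd.
apply: inj_row_free => v vM; apply/rowP => i; rewrite mxE.
pose y := \sum_i v ord0 i *: p i.
have baryE k : bary y ord0 k = \sum_i v ord0 i * bary (p i) ord0 k.
  rewrite linear_sum summxE; apply: eq_bigr => j _.
  by rewrite linearZ mxE.
have bary0 k : bary y ord0 k = 0.
  rewrite baryE; have [kK|kK] := boolP (k \in K); last first.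
    by rewrite big1// => j _; have [_ _ ->] := pK j; rewrite ?mulr0.
  have /rowP/(_ (enum_rank_in kK k)) := vM.
  rewrite !mxE => vMk; rewrite -[RHS]vMk; apply: eq_bigr => j _.
  by rewrite !mxE enum_rankK_in// ord1.
apply: p_free i; last first.
  by apply: bary_inj; rewrite linear0; apply/rowP => k; rewrite -/y bary0 mxE.
(* The coordinates of each [p j] sum to 1, so those of [y] sum to the total of the coefficients
   [v]. *)
transitivity (\sum_k bary y ord0 k); last by rewrite big1.
under [RHS]eq_bigr do rewrite baryE.
rewrite exchange_big /=; apply: eq_bigr => j _.
by have [pj1 _ _] := pK j; rewrite -mulr_sumr pj1 mulr1.
Qed.

(** * Convexity under linear maps *)

Lemma forget0_is_linear (R : realType) n : linear (@forget0 R n).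
Proof. by move=> a x y; apply/rowP => i; rewrite !mxE. Qed.

HB.instance Definition _ (R : realType) n :=
  GRing.isLinear.Build R 'rV[R]_n.+1 'rV[R]_n _ (@forget0 R n)
    (@forget0_is_linear R n).

Lemma convex_set_image (R : realType) (M N : lmodType R)
    (f : {linear M -> N}) (A : set M) :
  convex_set A -> @convex_set R N (f @` A).
Proof.
move=> /convex_setP cA; apply/convex_setP => _ _ t t0 t1 [x Ax <-] [y Ay <-].
exists (t *: x + (1 - t) *: y); first exact: cA.
by rewrite linearD !linearZ.
Qed.

Lemma convex_set_preimage (R : realType) (M N : lmodType R)
    (f : {linear M -> N}) (A : set N) :
  convex_set A -> @convex_set R M (f @^-1` A).
Proof.
move=> /convex_setP cA; apply/convex_setP => x y t t0 t1 Ax Ay.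
by rewrite /preimage /= linearD !linearZ; apply: cA.
Qed.

Lemma convex_conv_hull (R : realType) n (A : set 'rV[R]_n) :
  convex_set (conv_hull A).
Proof.
apply/convex_setP => x y t t0 t1 Ax Ay B BA.
by have [/convex_setP cB _] := BA; apply: cB; [| |exact: Ax|exact: Ay].
Qed.

(** * Face numbers of simplicial complexes *)

Section FaceNumbers.

Local Open Scope nat_scope.

(* Double counting of the pairs t \subset s of faces with #|t| = j and
   #|s| = j.+1. *)
Lemma local_LYM n (D : {set {set 'I_n}}) (j : nat) :
  simplicial_complex D -> fnum D j.+1 * j.+1 <= fnum D j * (n - j).
Proof.
move=> [_ _ Ddown].
pose L i := [set s in D | #|s| == i]%SET.
have -> : fnum D j.+1 * j.+1 =
    \sum_(s in L j.+1) \sum_(t in L j | t \subset s) 1.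
  (* A face with [j.+1] elements has exactly [j.+1] subsets of size [j], all in [D] by closure. *)
  rewrite -sum_nat_const; apply: eq_bigr => s; rewrite inE => /andP[sD /eqP sj].
  rewrite sum1dep_card -[LHS]binSn -[in LHS]sj -cards_draws.
  apply: eq_card => t; rewrite !inE.
  case: (boolP (t \subset s)) => [ts|_]; last by rewrite andbF.
  by rewrite (Ddown _ _ ts sD) andbT.
rewrite (exchange_big_dep (mem (L j))) /=; last by move=> s t _ /andP[].
rewrite -[fnum D j]/#|L j| -sum_nat_const.
apply: leq_sum => t; rewrite inE => /andP[_ /eqP tj].
have <- : #|~: t| = n - j by rewrite cardsCs finset.setCK card_ord tj.
(* Every such [s] is [i |: t] with [i] outside [t], which leaves at most [n - j] choices. *)
apply: leq_trans (leq_imset_card (fun i => i |: t)%SET _).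
rewrite sum1dep_card; apply/subset_leq_card/fintype.subsetP => s.
rewrite !inE => /and3P[/andP[_ /eqP sj] _ ts].
have /cards1P[i si] : #|s :\: t| == 1 by rewrite cardsDS// sj tj subSnn.
apply/imsetP; exists i; first by have := set11 i; rewrite -si !inE => /andP[].
by rewrite -si finset.setUC -{1}(finset.setIidPr ts) finset.setID.
Qed.

(** After multiplication by [j.+1], the identity [j.+1 * 'C(n, j.+1) = (n - j) * 'C(n, j)] reduces
    this to [local_LYM]. *)
Lemma fnum_ratio_le n (D : {set {set 'I_n}}) (j : nat) :
  simplicial_complex D -> j <= n ->
  fnum D j.+1 * 'C(n, j) <= fnum D j * 'C(n, j.+1).
Proof.
move=> /(local_LYM j) LYM jn; rewrite -(@leq_pmul2l j.+1)//.
by rewrite mulnA [leqRHS]mulnCA mul_bin_left !mulnA leq_mul// mulnC.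
Qed.

Lemma fnum1 n (D : {set {set 'I_n}}) : simplicial_complex D -> fnum D 1 = n.
Proof.
move=> [_ D1 _]; rewrite -[RHS]bin1 -[in RHS](card_ord n) -card_draws.
apply: eq_card => s; rewrite !inE andbC.
by case: cards1P => //= -[i ->]; rewrite D1.
Qed.

(** The skeleton of dimension [k - 1] of the full simplex, whose projected f-vector is
    [Ftilde R n k]. *)
Definition skeleton n k : {set {set 'I_n}} :=
  [set s : {set 'I_n} | #|s| <= k]%SET.

Lemma simplicial_complex_skeleton n k :
  0 < k -> simplicial_complex (skeleton n k).
Proof.
move=> k0; split=> [|i|s t ts]; rewrite !inE ?cards0 ?cards1//.
exact: leq_trans (subset_leq_card ts).
Qed.

Lemma fnum_skeleton n k j :
  fnum (skeleton n k) j = if j <= k then 'C(n, j) else 0.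
Proof.
case: ifPn => jk; last first.
  apply: eq_card0 => s; rewrite !inE.
  by apply/negP => /andP[sk /eqP sj]; rewrite -sj sk in jk.
rewrite -[in RHS](card_ord n) -card_draws; apply: eq_card => s; rewrite !inE.
by case: eqP => [->|]; rewrite ?jk ?andbF.
Qed.

End FaceNumbers.

(** * The projected Kozlov simplex and its inequalities *)

Lemma forget0_skeleton (R : realType) n k :
  forget0 (fvector R (skeleton n k)) = Ftilde R n k.
Proof.
by apply/rowP => i; rewrite !mxE fnum_skeleton; case: ifP.
Qed.

Lemma crd_forget0 (R : realType) n (D : {set {set 'I_n}}) j :
  (0 < j <= n)%N -> crd (forget0 (fvector R D)) j = (fnum D j)%:R.
Proof.
case: j => // j jn0; have jn : (j < n)%N := jn0.
by rewrite (crd_ord _ (Ordinal jn)) !mxE.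
Qed.

Lemma simplex_faceT (R : realType) n (x : 'rV[R]_n) : (0 < n)%N ->
  simplex_face R n [set: 'I_n]%SET x <->
  [/\ crd x 1 = n%:R,
      forall j : nat, (1 <= j < n)%N ->
        crd x j / 'C(n, j)%:R >= crd x j.+1 / 'C(n, j.+1)%:R
    & crd x n / 'C(n, n)%:R >= 0].
Proof.
move=> n0; have n_neq0 : n%:R != 0 :> R by rewrite pnatr_eq0 -lt0n.
split=> [[x1 x0 _]|[x1 xle xn0]].
  have x0' j : (j < n)%N -> normalized_crd x j.+2 <= normalized_crd x j.+1.
    by move=> jn; have := x0 (Ordinal jn); rewrite mxE subr_ge0.
  split=> [|[//|j] /= /ltnW jn|]; last 2 first.
  - exact: x0'.
  (* The last barycentric coordinate is [normalized_crd x n], since the term subtracted from it is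
     0. *)
  - case: n n0 {n_neq0 x1 x0} x x0' => // n _ x /(_ n (ltnSn n)).
    by rewrite normalized_crd_gt.
  by apply: (mulIf (invr_neq0 n_neq0)); rewrite -sum_bary x1 divff.
split=> [|i|i]; last by rewrite inE.
  by rewrite sum_bary x1 divff.
rewrite mxE subr_ge0; have [iN|iN] := ltnP i.+1 n; first exact: xle.
have {iN}iN : i.+1 = n by apply/eqP; rewrite eqn_leq iN ltn_ord.
by rewrite normalized_crd_gt ?iN.
Qed.

Lemma projKozE (R : realType) n :
  (0 < n)%N -> projKoz R n = simplex_face R n [set: 'I_n]%SET.
Proof.
move=> n0; apply/seteqP; split.
  (* The preimage of the simplex under [forget0] is convex, so it contains the hull once it contains
     every f-vector. *)
  move=> _ [x Kx <-]; move: x Kx; rewrite -/(@preimage _ _ (@forget0 R n) _).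
  apply: smallest_sub.
    exact: (@convex_set_preimage R _ _ (@forget0 R n))
      (@convex_simplex_face _ _ _).
  move=> _ [D sD <-]; apply/simplex_faceT => //; split.
  - by rewrite crd_forget0// fnum1.
  - move=> j /andP[j0 jn].
    rewrite !crd_forget0 ?j0 ?(ltnW jn)//.
    rewrite ler_pdivrMr ?ltr0n ?bin_gt0// mulrAC.
    rewrite ler_pdivlMr ?ltr0n ?bin_gt0//; last exact: ltnW.
    by rewrite -!natrM ler_nat fnum_ratio_le// ltnW.
  - by rewrite crd_forget0 ?n0 ?leqnn// divr_ge0.
(* Conversely, the image is convex and contains each vertex as the image of a skeleton. *)
apply: simplex_face_sub.
  exact: (@convex_set_image R _ _ (@forget0 R n)) (@convex_conv_hull _ _ _).
move=> k _; rewrite -forget0_skeleton.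
exists (fvector R (skeleton n k.+1)) => //.
apply: sub_gen_smallest; exists (skeleton n k.+1) => //.
exact: simplicial_complex_skeleton.
Qed.

(** * Tight loci and opposite facets *)

Lemma tightE (R : realType) n (i : 'I_n) :
  tight R n i.+1 = [set x | bary x ord0 i = 0].
Proof.
rewrite /tight; case: ifPn => [_|].
  apply/seteqP; split=> x /=; rewrite mxE; last by move/subr0_eq.
  by rewrite /normalized_crd => ->; rewrite subrr.
(* At the last index the subtracted term of [bary] vanishes and ['C(n, n) = 1], so [x_n = 0] fits
   the same pattern. *)
rewrite -leqNgt => ni.
have iE : i.+1 = n by apply/eqP; rewrite eqn_leq ni ltn_ord.
apply/seteqP; split=> x /=;
  by rewrite mxE (@normalized_crd_gt _ _ _ i.+2)// subr0 /normalized_crd iE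
    binn divr1.
Qed.

Lemma simplex_face_tight (R : realType) n (i : 'I_n) :
  simplex_face R n [set: 'I_n]%SET `&` tight R n i.+1 =
  simplex_face R n [set~ i]%SET.
Proof.
rewrite tightE; apply/seteqP; split=> x /=.
  by move=> [[x1 x0 _] xi]; split=> // k; rewrite !inE negbK => /eqP ->.
move=> [x1 x0 xi]; split; last by apply: xi; rewrite !inE eqxx.
by split=> // k; rewrite inE.
Qed.

Lemma opposite_facetE (R : realType) n (i : 'I_n) :
  opposite_facet R n i.+1 = simplex_face R n [set~ i]%SET.
Proof.
apply: conv_hull_Ftilde => [l /andP[]//|k] /=.
by rewrite ltn_ord eqSS !inE.
Qed.

(** * Faces and facets from valid inequalities *)

Lemma dot_bary (R : realType) n (c x : 'rV[R]_n) :
  \sum_k c ord0 k * x ord0 k =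
  \sum_i bary x ord0 i * \sum_k c ord0 k * Ftilde R n i.+1 ord0 k.
Proof.
rewrite -[in LHS](baryK x); under eq_bigr do rewrite summxE mulr_sumr.
rewrite exchange_big /=; apply: eq_bigr => i _; rewrite mulr_sumr.
by apply: eq_bigr => k _; rewrite mxE mulrCA.
Qed.

(** The slack of a valid inequality at [x] is the barycentric average of its nonnegative slacks at
    the vertices, so it vanishes exactly when [x] is supported on the tight vertices; these form
    [K]. *)
Lemma is_face_simplex (R : realType) n (F : set 'rV[R]_n) :
  is_face (simplex_face R n [set: 'I_n]%SET) F ->
  exists K, F = simplex_face R n K.
Proof.
move=> [c [b [cb ->]]].
pose v (i : 'I_n) := \sum_k c ord0 k * Ftilde R n i.+1 ord0 k.
have vb i : 0 <= b - v i.
  by rewrite subr_ge0; apply: cb; apply/simplex_face_Ftilde; rewrite inE.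
have slack x : \sum_i bary x ord0 i = 1 ->
    b - \sum_k c ord0 k * x ord0 k = \sum_i bary x ord0 i * (b - v i).
  move=> x1; rewrite dot_bary -[b in LHS]mul1r -x1 mulr_suml -sumrB.
  by apply: eq_bigr => i _; rewrite mulrBr.
exists [set i | v i == b]%SET; apply/seteqP; split=> x /=.
  move=> [[x1 x0 _] xb]; split=> // i; rewrite inE => vi.
  have /eqP := slack _ x1.
  rewrite xb subrr eq_sym psumr_eq0 => [/allP/(_ i (mem_index_enum _))|k _].
    rewrite mulf_eq0 => /orP[/eqP //|]; rewrite subr_eq0 eq_sym.
    by rewrite (negPf vi).
  exact: mulr_ge0.
move=> [x1 x0 xv]; split; first by split=> // i; rewrite inE.
apply/eqP; rewrite eq_sym -subr_eq0 slack// big1// => i _.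
have [/eqP ->|vi] := boolP (v i == b); first by rewrite subrr mulr0.
by rewrite xv ?mul0r// inE.
Qed.

Lemma simplex_facet_is_face (R : realType) n (i : 'I_n) :
  is_face (simplex_face R n [set: 'I_n]%SET) (simplex_face R n [set~ i]%SET).
Proof.
(* The functional [- bary x ord0 i], read off on unit vectors; its validity with bound 0 is the
   nonnegativity of that coordinate. *)
pose c : 'rV[R]_n := \row_k (- bary 'e_k ord0 i).
have cE (x : 'rV[R]_n) : \sum_k c ord0 k * x ord0 k = - bary x ord0 i.
  rewrite [in RHS](row_sum_delta x) linear_sum summxE -sumrN.
  apply: eq_bigr => k _; rewrite [c _ _]mxE linearZ mulNr mulrC; congr (- _).
  by rewrite [RHS]mxE.
exists c, 0; split=> [x [_ x0 _]|]; first by rewrite cE oppr_le0.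
rewrite -simplex_face_tight tightE; congr (_ `&` _).
apply/seteqP; split=> x /=; rewrite cE; first by move=> ->; rewrite oppr0.
by move/eqP; rewrite oppr_eq0 => /eqP.
Qed.

(** Coordinates with sum 1 cannot all vanish; this rules out the empty face as a facet. *)
Lemma simplex_face0 (R : realType) n (x : 'rV[R]_n) :
  ~ simplex_face R n finset.set0 x.
Proof.
move=> [+ _ x0]; rewrite big1 => [/eqP|i _]; last by rewrite x0// inE.
by rewrite eq_sym oner_eq0.
Qed.

(** A nonempty face has dimension [#|K| - 1], so codimension one forces [K] to omit one vertex. For
    [n = 1] the simplex is a point and has no facet in this sense, while the right side would admit
    the empty set. *)
Lemma is_facet_simplex (R : realType) n (F : set 'rV[R]_n) : (2 <= n)%N ->
  is_facet (simplex_face R n [set: 'I_n]%SET) F <->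
  exists i, F = simplex_face R n [set~ i]%SET.
Proof.
move=> n2; have nE : n = n.-2.+2 by case: n n2 {F} => [|[]].
have dimT : has_affine_dim (simplex_face R n [set: 'I_n]%SET) n.-2.+1.
  by apply: simplex_face_dim; rewrite cardsT card_ord.
split=> [[/is_face_simplex[K ->] [d [dimP dimF]]]|[i ->]]; last first.
  split; first exact: simplex_facet_is_face.
  exists n.-2; split=> //; apply: simplex_face_dim.
  by rewrite cardsC1 card_ord {1}nE.
have [dn] := has_affine_dim_uniq dimP dimT; subst d.
have Kn : #|K| = n.-2.+1.
  case KE : #|K| => [|e].
    have [[p [pF _]] _] := dimF.
    by have := pF ord0; rewrite (cards0_eq KE) => /simplex_face0.
  by rewrite (has_affine_dim_uniq (simplex_face_dim R KE) dimF).
have /eqP/cards1P[i iK] : #|~: K| = 1%N.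
  by rewrite cardsCs finset.setCK card_ord Kn {1}nE subSnn.
by exists i; rewrite -iK finset.setCK.
Qed.

Theorem corollary16 (R : realType) (n : nat) (n_ge1 : (1 <= n)%N) :
  [/\ projKoz R n =
        [set x : 'rV[R]_n |
          [/\ crd x 1 = n%:R,
              (forall j : nat, (1 <= j < n)%N ->
                 crd x j / 'C(n, j)%:R >= crd x j.+1 / 'C(n, j.+1)%:R)
            & crd x n / 'C(n, n)%:R >= 0]],
      (2 <= n)%N ->
        (forall F : set 'rV[R]_n,
           is_facet (projKoz R n) F <->
           exists2 j : nat, (1 <= j <= n)%N & F = projKoz R n `&` tight R n j) /\
        (forall j k : nat, (1 <= j <= n)%N -> (1 <= k <= n)%N ->
           projKoz R n `&` tight R n j = projKoz R n `&` tight R n k -> j = k),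
      forall j : nat, (1 <= j <= n - 1)%N ->
        opposite_facet R n j =
          projKoz R n `&`
          [set x | crd x j / 'C(n, j)%:R = crd x j.+1 / 'C(n, j.+1)%:R]
    & opposite_facet R n n = projKoz R n `&` [set x | crd x n = 0]].
Proof.
have idx j : (1 <= j <= n)%N -> exists i : 'I_n, j = i.+1.
  by case: j => // j jn; exists (Ordinal (jn : (j < n)%N)).
rewrite projKozE//; split.
- by apply/seteqP; split=> x /simplex_faceT; apply.
- move=> n2; split=> [F|j k /idx[i ->] /idx[i' ->]].
    rewrite is_facet_simplex//; split=> [[i ->]|[j /idx[i ->] ->]]; last first.
      by exists i; rewrite simplex_face_tight.
    by exists i.+1; rewrite ?simplex_face_tight//= ltn_ord.
  rewrite !simplex_face_tight => /simplex_face_inj/setP/(_ i).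
  by rewrite !inE eqxx => /esym/negbFE/eqP ->.
- move=> j /andP[j1 jn]; have {}jn : (j < n)%N by rewrite -(subnK n_ge1) addn1.
  have [|i iE] := idx j; first by rewrite j1 ltnW.
  (* The opposite facet and the tight locus are both the face omitting [i]; [jn] selects the branch
     of [tight]. *)
  by have := simplex_face_tight R i; rewrite -opposite_facetE -iE /tight jn.
- have [|i iE] := idx n; first by rewrite n_ge1 leqnn.
  by have := simplex_face_tight R i; rewrite -opposite_facetE -iE /tight ltnn.
Qed.
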